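(* Let $\alpha_0,\alpha_1$ be complex parameters with $\alpha_0+\alpha_1=0$. The birational transformations $$\begin{aligned}x&=\tfrac14q_2-2q_1q_2,\\ y&=-\tfrac18p_2+q_1p_2+\tfrac14p_1q_2-6q_1p_1q_2-2q_2^2p_2+2\alpha_0q_2,\\ z&=q_2,\\ w&=-\tfrac12p_2+p_1q_2\end{aligned}$$ take the Hamiltonian system $$dq_m=\sum_{i=1}^{3}\frac{\partial K_i}{\partial p_m}\,dt_i,\qquad dp_m=-\sum_{i=1}^{3}\frac{\partial K_i}{\partial q_m}\,dt_i\qquad(m=1,2),$$ with the polynomial Hamiltonians $K_1,K_2,K_3$ given in the context, to the system $$\begin{aligned} dx&=y\,dt_1+f_1(x,y,z,w)\,dt_2+f_2(x,y,z,w)\,dt_3,\\ dy&=A\,dt_1+f_3(x,y,z,w)\,dt_2+f_4(x,y,z,w)\,dt_3,\\ dz&=w\,dt_1+\Big(-\tfrac32w-y+\frac{3xw}{z}\Big)dt_2+B\,dt_3,\\ dw&=x\,dt_1+f_5(x,y,z,w)\,dt_2+f_6(x,y,z,w)\,dt_3, \end{aligned}$$ where $f_i(x,y,z,w)\in\mathbb{C}[x,y,z,w]$ and $$\begin{aligned}A=\frac{1}{z^2(8z^3+z-4x)}\Big(&6x^2w^2-2xzw^2-12x^3z-4xyzw+7x^2z^2+2yz^2w-2y^2z^2-\tfrac32xz^3-48xz^3w^2\\&+\tfrac{z^4}{8}+4z^4w^2+24x^2z^4+32yz^4w-12xz^5+2z^6+8z^8+8\alpha_0^2z^4\Big),\end{aligned}$$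 $$\begin{aligned}B=\frac{1}{64z^3(8z^3+z-4x)}\Big(&32x^2w^3-64x^3zw-64xyzw^2+48x^2z^2w+32y^2z^2w-12xz^3w+512xz^3w^3+z^4w\\&-64z^4w^3+128x^2z^4w-256yz^4w^2-128xz^5w+24z^6w+128z^8w+32\alpha_0xz^4-8\alpha_0z^5\\&+128\alpha_0xz^6-96\alpha_0z^7-256\alpha_0z^9-128\alpha_0^2z^4w+32\alpha_1xz^4-8\alpha_1z^5+128\alpha_1xz^6\\&-96\alpha_1z^7-256\alpha_1z^9\Big).\end{aligned}$$
   Context: The Hamiltonians, in the independent variables $t_1,t_2,t_3$ respectively, are $$K_1=q_1p_1^2+q_1^2-\alpha_0p_1+\tfrac14q_2^2-\tfrac14p_2^2+p_1q_2p_2,$$ $$K_2=q_2^2p_2^2-\tfrac14q_2^2+\tfrac14p_2^2-2\alpha_0q_2p_2+q_1q_2^2+q_1p_2^2-p_1q_2p_2+p_1^2q_2^2,$$ $$\begin{aligned}K_3=&\tfrac12q_1^2p_1^4+q_1^3p_1^2+\tfrac12q_1^4-\alpha_0q_1p_1^3+\alpha_1q_1^2p_1+\tfrac12\alpha_0^2p_1^2+\tfrac1{32}q_2^4+\tfrac1{32}p_2^4-\tfrac1{16}q_2^2p_2^2+q_1p_1^3q_2p_2\\&+\tfrac12p_1^2q_2^2p_2^2-\tfrac14q_1p_1^2p_2^2-\tfrac14p_1q_2p_2^3+q_1^2p_1q_2p_2+\tfrac14q_1p_1^2q_2^2+\tfrac14p_1q_2^3p_2-\alpha_0p_1^2q_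2p_2\\&+\tfrac14\alpha_0p_1p_2^2+\tfrac14\alpha_1p_1q_2^2.\end{aligned}$$
   Formalization: As printed the claim fails: (1/4)q_1^2 q_2^2 - (1/4)q_1^2 p_2^2 is added to K_3, so that its dt_3-coefficient of dz is B; and the f_i, which are not polynomials, are polynomials in x,y,z,w divided by a power of z(8z^3+z-4x), with the systems compared where this is nonzero. *)

(* Defs.v *)
From HB Require Import structures.
From mathcomp Require Import all_boot all_order all_algebra.
From mathcomp Require Import complex.
From mathcomp Require mpoly.
From mathcomp Require Import all_classical all_reals all_analysis.

Set Implicit Arguments.
Unset Strict Implicit.
Unset Printing Implicit Defensive.

Import Order.TTheory GRing.Theory Num.Theory.
Import numFieldNormedType.Exports.
(* The notations of mpoly clash with those of mathcomp-analysis. *)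
Import -(notations) mpoly.

Local Open Scope classical_set_scope.
Local Open Scope ring_scope.

(* Everything is stated over an abstract numFieldType, so that the topology of
   the field is inferred; the theorem takes C := R[i] with R : realType.  There,
   differentiability is complex differentiability. *)

Section Systems.
Variable C : numFieldType.

(* The one-form identity  du = a1 dt_1 + a2 dt_2 + a3 dt_3  at the point t. *)
Definition total_differential (t : 'rV[C]_3) (u : 'rV[C]_3 -> C)
    (a1 a2 a3 : C) : Prop :=
  is_diff t u (fun h : 'rV[C]_3 =>
    a1 * h 0 0 + a2 * h 0 1 + a3 * h 0 2%:R).

Definition partial_q1 (K : C -> C -> C -> C -> C) (q1 p1 q2 p2 : C) : C :=
  derive1 (fun s : C => K s p1 q2 p2) q1.
Definition partial_p1 (K : C -> C -> C -> C -> C) (q1 p1 q2 p2 : C) : C :=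
  derive1 (fun s : C => K q1 s q2 p2) p1.
Definition partial_q2 (K : C -> C -> C -> C -> C) (q1 p1 q2 p2 : C) : C :=
  derive1 (fun s : C => K q1 p1 s p2) q2.
Definition partial_p2 (K : C -> C -> C -> C -> C) (q1 p1 q2 p2 : C) : C :=
  derive1 (fun s : C => K q1 p1 q2 s) p2.

Definition hamiltonian_system_at (K1 K2 K3 : C -> C -> C -> C -> C)
    (q1 p1 q2 p2 : 'rV[C]_3 -> C) (t : 'rV[C]_3) : Prop :=
  let d (D : (C -> C -> C -> C -> C) -> C -> C -> C -> C -> C) K :=
    D K (q1 t) (p1 t) (q2 t) (p2 t) in
  [/\ total_differential t q1
        (d partial_p1 K1) (d partial_p1 K2) (d partial_p1 K3),
      total_differential t p1
        (- d partial_q1 K1) (- d partial_q1 K2) (- d partial_q1 K3),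
      total_differential t q2
        (d partial_p2 K1) (d partial_p2 K2) (d partial_p2 K3) &
      total_differential t p2
        (- d partial_q2 K1) (- d partial_q2 K2) (- d partial_q2 K3)].

Section Hamiltonians.
Variables alpha0 alpha1 : C.

Definition K1 (q1 p1 q2 p2 : C) : C :=
  q1 * p1 ^+ 2 + q1 ^+ 2 - alpha0 * p1 + 1 / 4 * q2 ^+ 2 - 1 / 4 * p2 ^+ 2
  + p1 * q2 * p2.

Definition K2 (q1 p1 q2 p2 : C) : C :=
  q2 ^+ 2 * p2 ^+ 2 - 1 / 4 * q2 ^+ 2 + 1 / 4 * p2 ^+ 2
  - 2 * alpha0 * q2 * p2 + q1 * q2 ^+ 2 + q1 * p2 ^+ 2 - p1 * q2 * p2
  + p1 ^+ 2 * q2 ^+ 2.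

Definition K3_printed (q1 p1 q2 p2 : C) : C :=
  1 / 2 * q1 ^+ 2 * p1 ^+ 4 + q1 ^+ 3 * p1 ^+ 2 + 1 / 2 * q1 ^+ 4
  - alpha0 * q1 * p1 ^+ 3 + alpha1 * q1 ^+ 2 * p1
  + 1 / 2 * alpha0 ^+ 2 * p1 ^+ 2 + 1 / 32 * q2 ^+ 4 + 1 / 32 * p2 ^+ 4
  - 1 / 16 * q2 ^+ 2 * p2 ^+ 2 + q1 * p1 ^+ 3 * q2 * p2
  + 1 / 2 * p1 ^+ 2 * q2 ^+ 2 * p2 ^+ 2 - 1 / 4 * q1 * p1 ^+ 2 * p2 ^+ 2
  - 1 / 4 * p1 * q2 * p2 ^+ 3 + q1 ^+ 2 * p1 * q2 * p2
  + 1 / 4 * q1 * p1 ^+ 2 * q2 ^+ 2 + 1 / 4 * p1 * q2 ^+ 3 * p2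
  - alpha0 * p1 ^+ 2 * q2 * p2 + 1 / 4 * alpha0 * p1 * p2 ^+ 2
  + 1 / 4 * alpha1 * p1 * q2 ^+ 2.

(* The printed K3 does not Poisson-commute with K1 and K2, and the printed B
   below does not equal d(K3_printed)/dp2.  Adding (1/4) q1^2 (q2^2 - p2^2)
   restores both when alpha0 + alpha1 = 0. *)
Definition K3 (q1 p1 q2 p2 : C) : C :=
  K3_printed q1 p1 q2 p2
  + 1 / 4 * q1 ^+ 2 * q2 ^+ 2 - 1 / 4 * q1 ^+ 2 * p2 ^+ 2.

Definition x_of (q1 p1 q2 p2 : C) : C := 1 / 4 * q2 - 2 * q1 * q2.

Definition y_of (q1 p1 q2 p2 : C) : C :=
  - (1 / 8) * p2 + q1 * p2 + 1 / 4 * p1 * q2 - 6 * q1 * p1 * q2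
  - 2 * q2 ^+ 2 * p2 + 2 * alpha0 * q2.

Definition z_of (q1 p1 q2 p2 : C) : C := q2.

Definition w_of (q1 p1 q2 p2 : C) : C := - (1 / 2) * p2 + p1 * q2.

Definition A (x y z w : C) : C :=
  (6 * x ^+ 2 * w ^+ 2 - 2 * x * z * w ^+ 2 - 12 * x ^+ 3 * z
   - 4 * x * y * z * w + 7 * x ^+ 2 * z ^+ 2 + 2 * y * z ^+ 2 * w
   - 2 * y ^+ 2 * z ^+ 2 - 3 / 2 * x * z ^+ 3 - 48 * x * z ^+ 3 * w ^+ 2
   + z ^+ 4 / 8 + 4 * z ^+ 4 * w ^+ 2 + 24 * x ^+ 2 * z ^+ 4
   + 32 * y * z ^+ 4 * w - 12 * x * z ^+ 5 + 2 * z ^+ 6 + 8 * z ^+ 8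
   + 8 * alpha0 ^+ 2 * z ^+ 4)
  / (z ^+ 2 * (8 * z ^+ 3 + z - 4 * x)).

Definition B (x y z w : C) : C :=
  (32 * x ^+ 2 * w ^+ 3 - 64 * x ^+ 3 * z * w - 64 * x * y * z * w ^+ 2
   + 48 * x ^+ 2 * z ^+ 2 * w + 32 * y ^+ 2 * z ^+ 2 * w
   - 12 * x * z ^+ 3 * w + 512 * x * z ^+ 3 * w ^+ 3 + z ^+ 4 * w
   - 64 * z ^+ 4 * w ^+ 3 + 128 * x ^+ 2 * z ^+ 4 * w
   - 256 * y * z ^+ 4 * w ^+ 2 - 128 * x * z ^+ 5 * w + 24 * z ^+ 6 * w
   + 128 * z ^+ 8 * w + 32 * alpha0 * x * z ^+ 4 - 8 * alpha0 * z ^+ 5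
   + 128 * alpha0 * x * z ^+ 6 - 96 * alpha0 * z ^+ 7
   - 256 * alpha0 * z ^+ 9 - 128 * alpha0 ^+ 2 * z ^+ 4 * w
   + 32 * alpha1 * x * z ^+ 4 - 8 * alpha1 * z ^+ 5
   + 128 * alpha1 * x * z ^+ 6 - 96 * alpha1 * z ^+ 7
   - 256 * alpha1 * z ^+ 9)
  / (64 * z ^+ 3 * (8 * z ^+ 3 + z - 4 * x)).

Definition transformed_system_at (f1 f2 f3 f4 f5 f6 : C -> C -> C -> C -> C)
    (x y z w : 'rV[C]_3 -> C) (t : 'rV[C]_3) : Prop :=
  let ev (f : C -> C -> C -> C -> C) := f (x t) (y t) (z t) (w t) in
  [/\ total_differential t x (y t) (ev f1) (ev f2),
      total_differential t y (ev A) (ev f3) (ev f4),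
      total_differential t z (w t)
        (- (3 / 2) * w t - y t + 3 * x t * w t / z t) (ev B) &
      total_differential t w (x t) (ev f5) (ev f6)].

End Hamiltonians.

(* The locus where A, B and 3xw/z have no pole. *)
Definition sigma (x z : C) : C := z * (8 * z ^+ 3 + z - 4 * x).

Definition point4 (a b c d : C) : 'rV[C]_4 := \row_j [:: a; b; c; d]`_j.

Definition peval (g : mpoly 4 C) (v : 'rV[C]_4) : C :=
  meval (v 0) g.

(* The f_i cannot be polynomials: for instance f1, the dt_2-coefficient of dx,
   has a pole along z = 0.  Being an element of C[x,y,z,w][1/sigma] is the
   strongest regularity that holds: f_i is a rational function whose poles lie
   on those of A and B. *)
Definition regular_off_sigma (f : C -> C -> C -> C -> C) : Prop :=
  exists (g : mpoly 4 C) (k : nat), forall x y z w : C,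
    sigma x z != 0 -> f x y z w = peval g (point4 x y z w) / sigma x z ^+ k.

(* phi is a rational map, regular on the dense Zariski-open set {d <> 0}. *)
Definition rational_off (d : mpoly 4 C)
    (phi : 'rV[C]_4 -> 'rV[C]_4) : Prop :=
  d != 0 /\
  forall j : 'I_4, exists g : mpoly 4 C, exists k : nat,
    forall v, peval d v != 0 -> phi v 0 j = peval g v / peval d v ^+ k.

(* phi restricts to an isomorphism between two dense principal open sets. *)
Definition birational (phi : 'rV[C]_4 -> 'rV[C]_4) : Prop :=
  exists (psi : 'rV[C]_4 -> 'rV[C]_4) (d e : mpoly 4 C),
    [/\ rational_off d phi, rational_off e psi,
        forall v, peval d v != 0 -> peval e (phi v) != 0 /\ psi (phi v) = v &
        forall u, peval e u != 0 -> peval d (psi u) != 0 /\ phi (psi u) = u].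

Definition transformation (alpha0 : C) (v : 'rV[C]_4) : 'rV[C]_4 :=
  let q1 := v 0 0 in let p1 := v 0 1 in
  let q2 := v 0 2%:R in let p2 := v 0 3%:R in
  point4 (x_of q1 p1 q2 p2) (y_of alpha0 q1 p1 q2 p2)
         (z_of q1 p1 q2 p2) (w_of q1 p1 q2 p2).

End Systems.

(* Main.v *)
Require Import Defs.
From mathcomp Require Import all_boot all_order all_algebra.
From mathcomp Require Import complex ring.
From mathcomp Require mpoly.
From mathcomp Require Import all_classical all_reals all_analysis.
Import -(notations) mpoly.

(* Solving q1 from x, then p2 from w, turns y into a linear equation for p1 with
   leading coefficient - (8 z^3 + z - 4 x) / 2; hence the map is birational, with
   inverse regular where sigma != 0.  There the chain rule identifies total
   differentials of (q1, p1, q2, p2) with total differentials of (x, y, z, w)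
   through the tangent map, so the transformed system has as coefficients the
   derivatives of x, y, z, w along the Hamiltonian vector fields, rewritten in
   the new coordinates; A, B and the other displayed coefficients are then
   rational identities. *)

Import Order.TTheory GRing.Theory Num.Theory.
Import numFieldNormedType.Exports.
Local Open Scope ring_scope.
Local Open Scope complex_scope.

(** * Differentials of pointwise sums, products and quotients *)

Section Differentials.
Local Open Scope classical_set_scope.
Context {C : numFieldType} {V : normedModType C}.
Implicit Types (f g df dg : V -> C) (x : V).

(** This rule and those that follow write functions and differentials pointwise, so that they unify
    with explicit expressions in the coordinates. *)
Lemma is_diff_addf {f g df dg x} : is_diff x f df -> is_diff x g dg ->
  is_diff x (fun v => f v + g v) (fun h => df h + dg h).
Proof. exact: is_diffD. Qed.

Lemma is_diff_oppf {f df x} : is_diff x f df ->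
  is_diff x (fun v => - f v) (fun h => - df h).
Proof. exact: is_diffN. Qed.

Lemma is_diff_mulf {f g df dg x} : is_diff x f df -> is_diff x g dg ->
  is_diff x (fun v => f v * g v) (fun h => f x * dg h + g x * df h).
Proof. exact: is_diffM. Qed.

Lemma is_diff_expf {f df x} n : is_diff x f df ->
  is_diff x (fun v => f v ^+ n.+1) (fun h => n.+1%:R * f x ^+ n * df h).
Proof. by move=> /(is_diffX n); rewrite exprfctE. Qed.

Lemma is_diff_constf (c : C) x : is_diff x (fun=> c) (fun=> 0).
Proof. exact: is_diff_cst. Qed.

Lemma is_diff_invf {f df x} : is_diff x f df -> f x != 0 ->
  is_diff x (fun v => (f v)^-1) (fun h => - (f x ^- 2 * df h)).
Proof.
move=> [dfx dfE] fx0; split; first exact: differentiableV.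
by rewrite diffV//; apply/funext => h; rewrite /= dfE -[RHS]mulNr.
Qed.

(** Near [x] the remainder after the zero linear map vanishes identically, so it is certainly
    little-o of the increment. *)
Lemma is_diff_near0 {f x} : (\forall v \near x, f v = 0) ->
  is_diff x f (fun=> 0).
Proof.
move=> f0; have fx0 : f x = 0 := nbhs_singleton f0.
have [c0 shiftE] : continuous (\0 : V -> C) /\
    f \o shift x = cst (f x) + \0 +o_ 0 id.
  split; first exact: cst_continuous.
  apply/eqaddoP => e e0.
  have : \forall h \near (0 : V), f (h + x) = 0.
    by move: f0; rewrite (near_shift 0) /= subr0.
  apply: filterS => h fh0.
  rewrite (_ : (_ - _) h = f (h + x) - (f x + 0))// fh0 fx0 addr0 subr0 normr0.
  by rewrite mulr_ge0// ltW.
(* Uniqueness identifies the chosen differential ['d f x]; differentiability then follows from the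
   same expansion [shiftE]. *)
have dE : 'd f x = \0 :> (V -> C) by exact: diff_unique.
by split=> //; apply/diff_locallyP; rewrite dE.
Qed.

(** Write [g] as [f + (g - f)], where the second summand vanishes near [x] and so has zero
    differential. *)
Lemma is_diff_near {f g df x} : (\forall v \near x, f v = g v) ->
  is_diff x f df -> is_diff x g df.
Proof.
move=> fg dfx.
have /is_diff_near0 h0 : \forall v \near x, g v - f v = 0.
  by near=> v; rewrite (near fg v)// subrr.
have := is_diff_addf dfx h0.
under eq_fun do rewrite addrC subrK.
by under [X in is_diff _ _ X]eq_fun do rewrite addr0.
Unshelve. all: by end_near. Qed.

(** Differentiability of [f] is a conclusion here: it is recovered from the product, since
    [f = (f g) / g] wherever [g] is nonzero. This is how [q1] and [p1] are obtained from the new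
    coordinates. *)
Lemma is_diff_divr {f g d dg x} :
    is_diff x (fun v => f v * g v) d -> is_diff x g dg -> g x != 0 ->
  is_diff x f (fun h => (d h - f x * dg h) / g x).
Proof.
move=> dfg dgx gx0.
(* Only [g x != 0] is assumed; continuity extends it to a neighbourhood, which suffices by
   [is_diff_near]. *)
have gn0 : \forall v \near x, g v != 0.
  have /differentiable_continuous gc := @ex_diff _ _ _ _ _ _ _ dgx.
  exact: cvgr_neq0 gc gx0.
have fE : \forall v \near x, f v * g v * (g v)^-1 = f v.
  by near=> v; rewrite mulfK//; near: v.
apply: is_diff_eq (is_diff_near fE (is_diff_mulf dfg (is_diff_invf dgx gx0))) _.
apply/funext => h; field; exact: gx0.
Unshelve. all: by end_near. Qed.

End Differentials.

Lemma derive1_is_diff {C : numFieldType} {f df : C -> C} {x : C} :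
  is_diff x f df -> f^`()%classic x = df 1.
Proof. by move=> [dfx <-]; rewrite derive1E'. Qed.

(* [is_diff] is a class: [apply] would let instance search pick derivatives that
   are not in pointwise form, hence [notypeclasses refine]. *)
Ltac solve_is_diff :=
  repeat first
    [ notypeclasses refine (is_diff_constf _ _)
    | notypeclasses refine (is_diff_id _)
    | eassumption
    | notypeclasses refine (is_diff_addf _ _)
    | notypeclasses refine (is_diff_oppf _)
    | notypeclasses refine (is_diff_expf _ _)
    | notypeclasses refine (is_diff_mulf _ _) ].

(** [etransitivity] leaves the derivative as an existential variable, which [solve_is_diff] fills in
    by following the syntax; [field] then compares it with the stated polynomial. *)
Ltac compute_partial :=
  rewrite /partial_q1 /partial_p1 /partial_q2 /partial_p2 /K1 /K2 /K3 /K3_printed;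
  etransitivity;
    [ notypeclasses refine (derive1_is_diff _); solve_is_diff | cbv beta; field ].

(** * Rings of regular functions on principal open sets of affine 4-space *)

Section RegularFunctions.
Context {C : numFieldType}.
Implicit Types (d g : mpoly 4 C) (f : 'rV[C]_4 -> C).

(** The condition that [rational_off] puts on each coordinate. The closure lemmas below prove it by
    induction on the syntax of an expression, without exhibiting [g] and [k]. *)
Definition regular_off d f := exists g (k : nat),
  forall v, peval d v != 0 -> f v = peval g v / peval d v ^+ k.

Lemma regular_off_const {d} (c : C) : regular_off d (fun=> c).
Proof.
by exists (mpolyC 4 c), 0%N => v _; rewrite /peval mevalC expr0 divr1.
Qed.

Lemma regular_off_coord {d} (j : 'I_4) : regular_off d (fun v => v 0 j).
Proof.
exists (mpolyX C (mnm1 j)), 0%N => v _.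
by rewrite /peval mevalXU expr0 divr1.
Qed.

Lemma regular_off_add {d f1 f2} : regular_off d f1 -> regular_off d f2 ->
  regular_off d (fun v => f1 v + f2 v).
Proof.
move=> [g1 [k1 f1E]] [g2 [k2 f2E]].
exists (g1 * d ^+ k2 + g2 * d ^+ k1), (k1 + k2)%N => v dv0.
rewrite f1E// f2E// /peval mevalD !mevalM !rmorphXn /= exprD.
by field; rewrite !expf_neq0.
Qed.

Lemma regular_off_mul {d f1 f2} : regular_off d f1 -> regular_off d f2 ->
  regular_off d (fun v => f1 v * f2 v).
Proof.
move=> [g1 [k1 f1E]] [g2 [k2 f2E]].
exists (g1 * g2), (k1 + k2)%N => v dv0.
rewrite f1E// f2E// /peval mevalM exprD.
by field; rewrite !expf_neq0.
Qed.

Lemma regular_off_opp {d f} : regular_off d f -> regular_off d (fun v => - f v).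
Proof.
by move=> [g [k fE]]; exists (- g), k => v dv0; rewrite fE// /peval mevalN mulNr.
Qed.

Lemma regular_off_exp {d f} n : regular_off d f ->
  regular_off d (fun v => f v ^+ n).
Proof.
move=> [g [k fE]]; exists (g ^+ n), (k * n)%N => v dv0.
by rewrite fE// /peval rmorphXn /= exprM expr_div_n.
Qed.

(** A factor of [d] becomes a unit once [d] is inverted: if [d = f1 f2] then [1 / f1 = f2 / d], at
    the cost of one more power of [d]. *)
Lemma regular_off_inv {d f1} f2 : regular_off d f2 ->
  (forall v, peval d v = f1 v * f2 v) -> regular_off d (fun v => (f1 v)^-1).
Proof.
move=> [g [k f2E]] dE; exists g, k.+1 => v dv0.
have := dv0; rewrite {1}dE mulf_eq0 negb_or => /andP[f10 f20].
have := f2E _ dv0; rewrite exprS invfM mulrCA => <-.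
by rewrite dE invfM -mulrA mulVf// mulr1.
Qed.

Lemma point4E (v : 'rV[C]_4) : point4 (v 0 0) (v 0 1) (v 0 2%:R) (v 0 3%:R) = v.
Proof.
apply/rowP => -[[|[|[|[|//]]]] i]; rewrite mxE /=; congr (v _ _); exact: val_inj.
Qed.

Lemma point4_0 (a b c d : C) : point4 a b c d 0 0 = a.
Proof. by rewrite mxE. Qed.
Lemma point4_1 (a b c d : C) : point4 a b c d 0 1 = b.
Proof. by rewrite mxE. Qed.
Lemma point4_2 (a b c d : C) : point4 a b c d 0 2%:R = c.
Proof. by rewrite mxE. Qed.
Lemma point4_3 (a b c d : C) : point4 a b c d 0 3%:R = d.
Proof. by rewrite mxE. Qed.

Lemma regular_off_point4 {d f1 f2 f3 f4} :
  regular_off d f1 -> regular_off d f2 -> regular_off d f3 -> regular_off d f4 ->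
  forall j, regular_off d (fun v => point4 (f1 v) (f2 v) (f3 v) (f4 v) 0 j).
Proof.
move=> f1d f2d f3d f4d j.
have -> : (fun v => point4 (f1 v) (f2 v) (f3 v) (f4 v) 0 j) =
    [:: f1; f2; f3; f4]`_j.
  by case: j => -[|[|[|[|//]]]] i; apply/funext => v; rewrite mxE.
by case: j => -[|[|[|[|//]]]] i.
Qed.

Definition sigma_poly : mpoly 4 C :=
  let z := mpolyX C (mnm1 2%:R) in
  z * (8 * z ^+ 3 + z - 4 * mpolyX C (mnm1 0)).

Lemma peval_sigma_poly v : peval sigma_poly v = sigma (v 0 0) (v 0 2%:R).
Proof.
rewrite /peval /sigma_poly.
by rewrite !(mevalB, mevalD, mevalM) !mevalXU !meval1 /sigma; ring.
Qed.

Lemma peval_neq0 d v : peval d v != 0 -> d != 0.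
Proof. by apply: contra_neq => ->; rewrite /peval meval0. Qed.

Lemma sigma_poly_neq0 : sigma_poly != 0.
Proof.
(* At [x = 0], [z = 1] the value is 9, which is nonzero in characteristic zero. *)
apply: (@peval_neq0 _ (point4 0 0 1 0)).
rewrite peval_sigma_poly point4_0 point4_2 (_ : sigma 0 1 = 9%:R) ?pnatr_eq0//.
by rewrite /sigma; ring.
Qed.

End RegularFunctions.

(** * Partial derivatives of the three Hamiltonians *)

Section Partials.
Context {C : numFieldType} (alpha0 alpha1 q1 p1 q2 p2 : C).

Lemma partial_q1_K1 : partial_q1 (K1 alpha0) q1 p1 q2 p2 =
  2 * q1 + p1 ^+ 2.
Proof. by compute_partial. Qed.

Lemma partial_p1_K1 : partial_p1 (K1 alpha0) q1 p1 q2 p2 =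
  2 * q1 * p1 + q2 * p2 - alpha0.
Proof. by compute_partial. Qed.

Lemma partial_q2_K1 : partial_q2 (K1 alpha0) q1 p1 q2 p2 =
  p1 * p2 + 1 / 2 * q2.
Proof. by compute_partial. Qed.

Lemma partial_p2_K1 : partial_p2 (K1 alpha0) q1 p1 q2 p2 =
  p1 * q2 - 1 / 2 * p2.
Proof. by compute_partial. Qed.

Lemma partial_q1_K2 : partial_q1 (K2 alpha0) q1 p1 q2 p2 =
  q2 ^+ 2 + p2 ^+ 2.
Proof. by compute_partial. Qed.

Lemma partial_p1_K2 : partial_p1 (K2 alpha0) q1 p1 q2 p2 =
  2 * p1 * q2 ^+ 2 - q2 * p2.
Proof. by compute_partial. Qed.

Lemma partial_q2_K2 : partial_q2 (K2 alpha0) q1 p1 q2 p2 =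
  2 * q1 * q2 + 2 * p1 ^+ 2 * q2 - p1 * p2 + 2 * q2 * p2 ^+ 2 - 1 / 2 * q2 -
  2 * p2 * alpha0.
Proof. by compute_partial. Qed.

Lemma partial_p2_K2 : partial_p2 (K2 alpha0) q1 p1 q2 p2 =
  2 * q1 * p2 - p1 * q2 + 2 * q2 ^+ 2 * p2 - 2 * q2 * alpha0 + 1 / 2 * p2.
Proof. by compute_partial. Qed.

Lemma partial_q1_K3 : partial_q1 (K3 alpha0 alpha1) q1 p1 q2 p2 =
  2 * q1 ^+ 3 + 3 * q1 ^+ 2 * p1 ^+ 2 + q1 * p1 ^+ 4 + 2 * q1 * p1 * q2 * p2
  + 2 * q1 * p1 * alpha1 + 1 / 2 * q1 * q2 ^+ 2 - 1 / 2 * q1 * p2 ^+ 2 + p1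
  ^+ 3 * q2 * p2 - p1 ^+ 3 * alpha0 + 1 / 4 * p1 ^+ 2 * q2 ^+ 2 - 1 / 4 * p1
  ^+ 2 * p2 ^+ 2.
Proof. by compute_partial. Qed.

Lemma partial_p1_K3 : partial_p1 (K3 alpha0 alpha1) q1 p1 q2 p2 =
  2 * q1 ^+ 3 * p1 + 2 * q1 ^+ 2 * p1 ^+ 3 + q1 ^+ 2 * q2 * p2 + q1 ^+ 2 *
  alpha1 + 3 * q1 * p1 ^+ 2 * q2 * p2 - 3 * q1 * p1 ^+ 2 * alpha0 + 1 / 2 *
  q1 * p1 * q2 ^+ 2 - 1 / 2 * q1 * p1 * p2 ^+ 2 + p1 * q2 ^+ 2 * p2 ^+ 2 - 2
  * p1 * q2 * p2 * alpha0 + p1 * alpha0 ^+ 2 + 1 / 4 * q2 ^+ 3 * p2 + 1 / 4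
  * q2 ^+ 2 * alpha1 - 1 / 4 * q2 * p2 ^+ 3 + 1 / 4 * p2 ^+ 2 * alpha0.
Proof. by compute_partial. Qed.

Lemma partial_q2_K3 : partial_q2 (K3 alpha0 alpha1) q1 p1 q2 p2 =
  q1 ^+ 2 * p1 * p2 + 1 / 2 * q1 ^+ 2 * q2 + q1 * p1 ^+ 3 * p2 + 1 / 2 * q1
  * p1 ^+ 2 * q2 + p1 ^+ 2 * q2 * p2 ^+ 2 - p1 ^+ 2 * p2 * alpha0 + 3 / 4 *
  p1 * q2 ^+ 2 * p2 + 1 / 2 * p1 * q2 * alpha1 - 1 / 4 * p1 * p2 ^+ 3 + 1 /
  8 * q2 ^+ 3 - 1 / 8 * q2 * p2 ^+ 2.
Proof. by compute_partial. Qed.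

Lemma partial_p2_K3 : partial_p2 (K3 alpha0 alpha1) q1 p1 q2 p2 =
  q1 ^+ 2 * p1 * q2 - 1 / 2 * q1 ^+ 2 * p2 + q1 * p1 ^+ 3 * q2 - 1 / 2 * q1
  * p1 ^+ 2 * p2 + p1 ^+ 2 * q2 ^+ 2 * p2 - p1 ^+ 2 * q2 * alpha0 + 1 / 4 *
  p1 * q2 ^+ 3 - 3 / 4 * p1 * q2 * p2 ^+ 2 + 1 / 2 * p1 * p2 * alpha0 - 1 /
  8 * q2 ^+ 2 * p2 + 1 / 8 * p2 ^+ 3.
Proof. by compute_partial. Qed.

End Partials.

Ltac solve_regular_off :=
  repeat first
    [ exact: regular_off_const | exact: regular_off_coord | eassumption
    | apply: regular_off_add | apply: regular_off_opp
    | apply: regular_off_exp | apply: regular_off_mul ].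

(** * The rational inverse and birationality *)

Section Transformation.
Context {C : numFieldType} (alpha0 : C).
Implicit Types x y z w : C.

Definition q1_of (x y z w : C) : C := 1 / 8 - x * (2 * z)^-1.

Definition p1_of (x y z w : C) : C :=
  - 2 * (y - 2 * alpha0 * z + 2 * w * (q1_of x y z w - 1 / 8 - 2 * z ^+ 2))
  * (8 * z ^+ 3 + z - 4 * x)^-1.

Definition p2_of (x y z w : C) : C := 2 * (p1_of x y z w * z - w).

Definition inverse_transformation (u : 'rV[C]_4) : 'rV[C]_4 :=
  let x := u 0 0 in let y := u 0 1 in
  let z := u 0 2%:R in let w := u 0 3%:R in
  point4 (q1_of x y z w) (p1_of x y z w) z (p2_of x y z w).

(** The pullback of [sigma] cuts out the open set on the source side; its polynomial form is
    [sigma_pullback]. *)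
Lemma sigma_of (q1 p1 q2 p2 : C) :
  sigma (x_of q1 p1 q2 p2) (z_of q1 p1 q2 p2) = 8 * q2 ^+ 2 * (q1 + q2 ^+ 2).
Proof. by rewrite /sigma /x_of /z_of; field. Qed.

Lemma sigma_neq0P x z :
  reflect (z != 0 /\ 8 * z ^+ 3 + z - 4 * x != 0) (sigma x z != 0).
Proof. by rewrite mulf_eq0 negb_or; exact: andP. Qed.

Lemma q1_ofK (q1 p1 q2 p2 : C) : q2 != 0 ->
  q1_of (x_of q1 p1 q2 p2) (y_of alpha0 q1 p1 q2 p2) (z_of q1 p1 q2 p2)
    (w_of q1 p1 q2 p2) = q1.
Proof. by move=> q20; rewrite /q1_of /x_of /z_of; field. Qed.

Lemma p1_ofK (q1 p1 q2 p2 : C) :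
  sigma (x_of q1 p1 q2 p2) (z_of q1 p1 q2 p2) != 0 ->
  p1_of (x_of q1 p1 q2 p2) (y_of alpha0 q1 p1 q2 p2) (z_of q1 p1 q2 p2)
    (w_of q1 p1 q2 p2) = p1.
Proof.
move=> /sigma_neq0P[q20 D0].
(* Multiplying through by [8 z^3 + z - 4 x] leaves a polynomial identity with constant denominators
   only. *)
rewrite /p1_of q1_ofK//; apply: (mulIf D0); rewrite mulfVK//.
by rewrite /x_of /y_of /z_of /w_of; field.
Qed.

Lemma p2_ofK (q1 p1 q2 p2 : C) :
  sigma (x_of q1 p1 q2 p2) (z_of q1 p1 q2 p2) != 0 ->
  p2_of (x_of q1 p1 q2 p2) (y_of alpha0 q1 p1 q2 p2) (z_of q1 p1 q2 p2)
    (w_of q1 p1 q2 p2) = p2.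
Proof. by move=> s0; rewrite /p2_of p1_ofK// /z_of /w_of; field. Qed.

Lemma x_ofK x y z w : z != 0 ->
  x_of (q1_of x y z w) (p1_of x y z w) z (p2_of x y z w) = x.
Proof. by move=> z0; rewrite /x_of /q1_of; field. Qed.

Lemma w_ofK x y z w :
  w_of (q1_of x y z w) (p1_of x y z w) z (p2_of x y z w) = w.
Proof. by rewrite /w_of /p2_of; field. Qed.

Lemma y_ofK x y z w : sigma x z != 0 ->
  y_of alpha0 (q1_of x y z w) (p1_of x y z w) z (p2_of x y z w) = y.
Proof.
move=> /sigma_neq0P[z0 D0].
by rewrite /y_of /p2_of /p1_of /q1_of; field; rewrite z0 D0.
Qed.

Definition sigma_pullback : mpoly 4 C :=
  8 * mpolyX C (mnm1 2%:R) ^+ 2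
    * (mpolyX C (mnm1 0) + mpolyX C (mnm1 2%:R) ^+ 2).

Lemma peval_sigma_pullback (v : 'rV[C]_4) : peval sigma_pullback v =
  8 * v 0 2%:R ^+ 2 * (v 0 0 + v 0 2%:R ^+ 2).
Proof.
by rewrite /peval /sigma_pullback !(mevalD, mevalM) !mevalXU !meval1; ring.
Qed.

Lemma regular_off_q1 :
  regular_off sigma_poly
    (fun u : 'rV[C]_4 => q1_of (u 0 0) (u 0 1) (u 0 2%:R) (u 0 3%:R)).
Proof.
have zV : regular_off sigma_poly (fun u : 'rV[C]_4 => (2 * u 0 2%:R)^-1).
  (* The cofactor of [2 z] in [sigma] is half of [8 z^3 + z - 4 x]. *)
  apply: (regular_off_inv
    (fun u => 1 / 2 * (8 * u 0 2%:R ^+ 3 + u 0 2%:R - 4 * u 0 0))).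
    by solve_regular_off.
  by move=> v; rewrite peval_sigma_poly /sigma; field.
by rewrite /q1_of; solve_regular_off.
Qed.

Lemma regular_off_p1 :
  regular_off sigma_poly
    (fun u : 'rV[C]_4 => p1_of (u 0 0) (u 0 1) (u 0 2%:R) (u 0 3%:R)).
Proof.
have DV : regular_off sigma_poly
    (fun u : 'rV[C]_4 => (8 * u 0 2%:R ^+ 3 + u 0 2%:R - 4 * u 0 0)^-1).
  apply: (regular_off_inv (fun u => u 0 2%:R)); first by solve_regular_off.
  by move=> v; rewrite peval_sigma_poly /sigma mulrC.
have q1_reg := regular_off_q1.
by rewrite /p1_of; solve_regular_off.
Qed.

Lemma regular_off_p2 :
  regular_off sigma_poly
    (fun u : 'rV[C]_4 => p2_of (u 0 0) (u 0 1) (u 0 2%:R) (u 0 3%:R)).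
Proof.
have p1_reg := regular_off_p1.
by rewrite /p2_of; solve_regular_off.
Qed.

Lemma birational_transformation : birational (transformation alpha0).
Proof.
exists inverse_transformation, sigma_pullback, sigma_poly; split.
- split.
    apply: (@peval_neq0 _ _ (point4 0 0 1 0)).
    rewrite peval_sigma_pullback point4_0 point4_2.
    by rewrite (_ : _ * _ = 8%:R) ?pnatr_eq0//; ring.
  by apply: regular_off_point4;
    rewrite /x_of /y_of /z_of /w_of; solve_regular_off.
- split; first exact: sigma_poly_neq0.
  apply: regular_off_point4.
  + exact: regular_off_q1.
  + exact: regular_off_p1.
  + exact: regular_off_coord.
  + exact: regular_off_p2.
(* The [p]-arguments of [sigma_of] are free; taking them from [v] turns the hypothesis into
   [sigma != 0] at the image of [v]. *)
- move=> v; rewrite peval_sigma_pullback -(sigma_of _ (v 0 1) _ (v 0 3%:R)) => s0.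
  rewrite peval_sigma_poly /transformation point4_0 point4_2; split=> //.
  rewrite /inverse_transformation point4_0 point4_1 point4_2 point4_3.
  have [q20 _] := sigma_neq0P _ _ s0.
  by rewrite q1_ofK// p1_ofK// p2_ofK// point4E.
- move=> u; rewrite peval_sigma_poly => s0; have [z0 _] := sigma_neq0P _ _ s0.
  rewrite peval_sigma_pullback /transformation /inverse_transformation.
  rewrite point4_0 point4_1 point4_2 point4_3.
  rewrite x_ofK// y_ofK// w_ofK /z_of point4E; split=> //.
  rewrite -(sigma_of _ (p1_of (u 0 0) (u 0 1) (u 0 2%:R) (u 0 3%:R)) _
                     (p2_of (u 0 0) (u 0 1) (u 0 2%:R) (u 0 3%:R))).
  by rewrite x_ofK.
Qed.

End Transformation.

(** * The chain rule for the transformation, in both directions *)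

Section TangentMap.
Context {C : numFieldType} (alpha0 : C).

(* The tangent map at (q1, p1, q2, p2), applied to the vector (a, b, c, d). *)
Definition dx_of (q1 p1 q2 p2 a b c d : C) : C :=
  1 / 4 * c - 2 * (a * q2 + q1 * c).

Definition dy_of (q1 p1 q2 p2 a b c d : C) : C :=
  - (1 / 8) * d + (a * p2 + q1 * d) + 1 / 4 * (b * q2 + p1 * c)
  - 6 * (a * p1 * q2 + q1 * b * q2 + q1 * p1 * c)
  - 2 * (2 * q2 * c * p2 + q2 ^+ 2 * d) + 2 * alpha0 * c.

Definition dz_of (q1 p1 q2 p2 a b c d : C) : C := c.

Definition dw_of (q1 p1 q2 p2 a b c d : C) : C :=
  - (1 / 2) * d + (b * q2 + p1 * c).

Variables (q1 p1 q2 p2 : 'rV[C]_3 -> C) (t : 'rV[C]_3).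

Let at_t (f : C -> C -> C -> C -> C -> C -> C -> C -> C) :=
  f (q1 t) (p1 t) (q2 t) (p2 t).
Let x s := x_of (q1 s) (p1 s) (q2 s) (p2 s).
Let y s := y_of alpha0 (q1 s) (p1 s) (q2 s) (p2 s).
Let z s := z_of (q1 s) (p1 s) (q2 s) (p2 s).
Let w s := w_of (q1 s) (p1 s) (q2 s) (p2 s).

(** The forward direction differentiates polynomials. Backwards, nothing is known about the old
    coordinates beforehand: they are recovered in the order [q2], [q1], [p1], [p2]. A nonvanishing
    multiple of [q1], then of [p1], is polynomial in functions already known to be differentiable,
    and [is_diff_divr] applies. *)
Lemma total_differential_transformation a1 a2 a3 b1 b2 b3 c1 c2 c3 d1 d2 d3 :
  sigma (x t) (z t) != 0 ->
  [/\ total_differential t q1 a1 a2 a3, total_differential t p1 b1 b2 b3,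
      total_differential t q2 c1 c2 c3 & total_differential t p2 d1 d2 d3] <->
  [/\ total_differential t x (at_t dx_of a1 b1 c1 d1)
        (at_t dx_of a2 b2 c2 d2) (at_t dx_of a3 b3 c3 d3),
      total_differential t y (at_t dy_of a1 b1 c1 d1)
        (at_t dy_of a2 b2 c2 d2) (at_t dy_of a3 b3 c3 d3),
      total_differential t z (at_t dz_of a1 b1 c1 d1)
        (at_t dz_of a2 b2 c2 d2) (at_t dz_of a3 b3 c3 d3) &
      total_differential t w (at_t dw_of a1 b1 c1 d1)
        (at_t dw_of a2 b2 c2 d2) (at_t dw_of a3 b3 c3 d3)].
Proof.
rewrite /at_t /dx_of /dy_of /dz_of /dw_of /total_differential => s0.
split=> [[dq1 dp1 dq2 dp2]|[dx dy dz dw]].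
- split=> //.
  + rewrite /x /x_of; notypeclasses refine (is_diff_eq _ _); first solve_is_diff.
    by apply/funext => h; ring.
  + rewrite /y /y_of; notypeclasses refine (is_diff_eq _ _); first solve_is_diff.
    by apply/funext => h; ring.
  + rewrite /w /w_of; notypeclasses refine (is_diff_eq _ _); first solve_is_diff.
    by apply/funext => h; ring.
- have dq2 : is_diff t q2 (fun h => c1 * h 0 0 + c2 * h 0 1 + c3 * h 0 2%:R).
    exact: dz.
  have [q20 D0] := sigma_neq0P _ _ s0.
  have dq1 : is_diff t q1 (fun h => a1 * h 0 0 + a2 * h 0 1 + a3 * h 0 2%:R).
    (* Solving the formula for [x] gives [q1 q2 = (q2 / 4 - x) / 2], whose right-hand side is
       differentiable. *)
    have dq12 : is_diff t (fun s => q1 s * q2 s)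
        (fun h => 1 / 2 * (1 / 4 * (c1 * h 0 0 + c2 * h 0 1 + c3 * h 0 2%:R) -
          ((1 / 4 * c1 - 2 * (a1 * q2 t + q1 t * c1)) * h 0 0 +
           (1 / 4 * c2 - 2 * (a2 * q2 t + q1 t * c2)) * h 0 1 +
           (1 / 4 * c3 - 2 * (a3 * q2 t + q1 t * c3)) * h 0 2%:R))).
      have -> : (fun s => q1 s * q2 s) = (fun s => 1 / 2 * (1 / 4 * q2 s - x s)).
        by apply/funext => s; rewrite /x /x_of; field.
      notypeclasses refine (is_diff_eq _ _); first solve_is_diff.
      by apply/funext => h; ring.
    apply: is_diff_eq (is_diff_divr dq12 dq2 q20) _.
    apply/funext => h; field; exact: q20.
  (* This is the coefficient of [p1] after [p2 = 2 (p1 q2 - w)] is substituted into the formula for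
     [y]. *)
  have D'0 : - (1 / 2) * (8 * q2 t ^+ 3 + q2 t - 4 * x t) != 0.
    by rewrite mulf_neq0// oppr_eq0 mulf_neq0 ?oner_eq0// invr_eq0 pnatr_eq0.
  have dp1 : is_diff t p1 (fun h => b1 * h 0 0 + b2 * h 0 1 + b3 * h 0 2%:R).
    notypeclasses refine (is_diff_eq
      (is_diff_divr (g := fun s => - (1 / 2) * (8 * q2 s ^+ 3 + q2 s - 4 * x s))
        _ _ D'0) _).
    + have -> : (fun s => p1 s * (- (1 / 2) * (8 * q2 s ^+ 3 + q2 s - 4 * x s))) =
          (fun s => y s - 2 * alpha0 * q2 s
                    + 2 * w s * (q1 s - 1 / 8 - 2 * q2 s ^+ 2)).
        by apply/funext => s; rewrite /x /x_of /y /y_of /w /w_of; field.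
      by solve_is_diff.
    + by solve_is_diff.
    + apply/funext => h; rewrite /x /x_of /w /w_of; field.
      (* [field] asks for this nonvanishing in the old coordinates, whereas [D0] states it in the
         new ones. *)
      rewrite [X in X != 0](_ : _ = 8 * z t ^+ 3 + z t - 4 * x t)//.
      by rewrite /x /x_of /z /z_of; field.
  split=> //.
  have -> : p2 = (fun s => 2 * (p1 s * q2 s - w s)).
    by apply/funext => s; rewrite /w /w_of; field.
  notypeclasses refine (is_diff_eq _ _); first solve_is_diff.
  by apply/funext => h; rewrite /w /w_of; field.
Qed.

End TangentMap.

(** * Derivatives of the new coordinates along the Hamiltonian vector fields *)

Section Flow.
Context {C : numFieldType}.

(** When [du] is the differential of a function [u], this is the Poisson bracket of [u] with [K]. *)
Definition along_flow (K : C -> C -> C -> C -> C)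
    (du : C -> C -> C -> C -> C -> C -> C -> C -> C) (q1 p1 q2 p2 : C) : C :=
  du q1 p1 q2 p2 (partial_p1 K q1 p1 q2 p2) (- partial_q1 K q1 p1 q2 p2)
    (partial_p2 K q1 p1 q2 p2) (- partial_q2 K q1 p1 q2 p2).

Context (alpha0 alpha1 : C).

Section Derivatives.
Variables (q1 p1 q2 p2 : C).

Let x := x_of q1 p1 q2 p2.
Let y := y_of alpha0 q1 p1 q2 p2.
Let z := z_of q1 p1 q2 p2.
Let w := w_of q1 p1 q2 p2.

Definition partialE := (
  @partial_q1_K1 C, @partial_p1_K1 C, @partial_q2_K1 C, @partial_p2_K1 C,
  @partial_q1_K2 C, @partial_p1_K2 C, @partial_q2_K2 C, @partial_p2_K2 C,
  @partial_q1_K3 C, @partial_p1_K3 C, @partial_q2_K3 C, @partial_p2_K3 C).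

Lemma x_along_K1 : along_flow (K1 alpha0) dx_of q1 p1 q2 p2 = y.
Proof. by rewrite /along_flow !partialE /dx_of /y /y_of; field. Qed.

Lemma z_along_K1 : along_flow (K1 alpha0) dz_of q1 p1 q2 p2 = w.
Proof. by rewrite /along_flow !partialE /dz_of /w /w_of; field. Qed.

Lemma w_along_K1 : along_flow (K1 alpha0) dw_of q1 p1 q2 p2 = x.
Proof. by rewrite /along_flow !partialE /dw_of /x /x_of; field. Qed.

Lemma z_along_K2 : q2 != 0 -> along_flow (K2 alpha0) dz_of q1 p1 q2 p2 =
  - (3 / 2) * w - y + 3 * x * w / z.
Proof.
move=> q20; rewrite /along_flow !partialE /dz_of.
rewrite /w /w_of /x /x_of /y /y_of /z /z_of.
by field.
Qed.

Lemma y_along_K1 : sigma x z != 0 ->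
  along_flow (K1 alpha0) (dy_of alpha0) q1 p1 q2 p2 = A alpha0 x y z w.
Proof.
move=> /sigma_neq0P[z0 D0].
(* The denominator of [A] is cleared before unfolding, which leaves a polynomial identity in the old
   coordinates. *)
rewrite /A; apply: (canRL (mulfK _)); first by rewrite mulf_neq0// expf_neq0.
rewrite /along_flow !partialE /dy_of /w /w_of /x /x_of /y /y_of /z /z_of.
by field.
Qed.

Lemma z_along_K3 : alpha0 + alpha1 = 0 -> sigma x z != 0 ->
  along_flow (K3 alpha0 alpha1) dz_of q1 p1 q2 p2 = B alpha0 alpha1 x y z w.
Proof.
(* The relation between the parameters enters here, by substituting [- alpha0] for [alpha1]. *)
rewrite addrC => /eqP; rewrite addr_eq0 => /eqP -> /sigma_neq0P[z0 D0].
rewrite /B; apply: (canRL (mulfK _)).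
  by rewrite mulf_neq0// mulf_neq0 ?expf_neq0 ?pnatr_eq0.
rewrite /along_flow !partialE /dz_of /w /w_of /x /x_of /y /y_of /z /z_of.
by field.
Qed.

End Derivatives.
End Flow.

(** * The transformed system and the regularity of its coefficients *)

Section NewCoordinates.
Context {C : numFieldType} (alpha0 alpha1 : C).

Definition in_new_coordinates (F : C -> C -> C -> C -> C) (x y z w : C) : C :=
  F (q1_of x y z w) (p1_of alpha0 x y z w) z (p2_of alpha0 x y z w).

Lemma in_new_coordinatesK F q1 p1 q2 p2 :
  sigma (x_of q1 p1 q2 p2) (z_of q1 p1 q2 p2) != 0 ->
  in_new_coordinates F (x_of q1 p1 q2 p2) (y_of alpha0 q1 p1 q2 p2)
    (z_of q1 p1 q2 p2) (w_of q1 p1 q2 p2) = F q1 p1 q2 p2.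
Proof.
move=> s0; have [z0 _] := sigma_neq0P _ _ s0.
by rewrite /in_new_coordinates q1_ofK// p1_ofK// p2_ofK.
Qed.

(** The hypothesis encodes polynomiality of [F] as stability of regular functions under
    substitution. It is applied to the four components of the inverse transformation, which are
    regular off [sigma_poly]. *)
Lemma regular_in_new_coordinates F :
  (forall d f1 f2 f3 f4, regular_off d f1 -> regular_off d f2 ->
    regular_off d f3 -> regular_off d f4 ->
    regular_off d (fun v => F (f1 v) (f2 v) (f3 v) (f4 v))) ->
  regular_off_sigma (in_new_coordinates F).
Proof.
move=> F_reg.
have [g [k gE]] := F_reg _ _ _ _ _ regular_off_q1 (regular_off_p1 alpha0)
  (regular_off_coord 2%:R) (regular_off_p2 alpha0).
exists g, k => x y z w s0; have := gE (point4 x y z w).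
by rewrite peval_sigma_poly !point4_0 point4_1 point4_2 point4_3; exact.
Qed.

Ltac solve_regular_along_flow :=
  apply: regular_in_new_coordinates => d f1 f2 f3 f4 f1d f2d f3d f4d;
  (* The derivatives must become explicit polynomials before the closure lemmas can follow their
     syntax. *)
  under eq_fun do rewrite /along_flow !partialE /dx_of /dy_of /dw_of;
  solve_regular_off.

Lemma regular_along_K2 :
  [/\ regular_off_sigma (in_new_coordinates (along_flow (K2 alpha0) dx_of)),
      regular_off_sigma
        (in_new_coordinates (along_flow (K2 alpha0) (dy_of alpha0))) &
      regular_off_sigma (in_new_coordinates (along_flow (K2 alpha0) dw_of))].
Proof. by split; solve_regular_along_flow. Qed.

Lemma regular_along_K3 :
  [/\ regular_off_sigma
        (in_new_coordinates (along_flow (K3 alpha0 alpha1) dx_of)),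
      regular_off_sigma
        (in_new_coordinates (along_flow (K3 alpha0 alpha1) (dy_of alpha0))) &
      regular_off_sigma
        (in_new_coordinates (along_flow (K3 alpha0 alpha1) dw_of))].
Proof. by split; solve_regular_along_flow. Qed.

(** By the chain rule the Hamiltonian system says that each new coordinate has its three
    [along_flow] derivatives as coefficients; it remains to recognise these in the displayed
    system. *)
Lemma hamiltonian_transformed_at (q1 p1 q2 p2 : 'rV[C]_3 -> C) t :
    let x t := x_of (q1 t) (p1 t) (q2 t) (p2 t) in
    let y t := y_of alpha0 (q1 t) (p1 t) (q2 t) (p2 t) in
    let z t := z_of (q1 t) (p1 t) (q2 t) (p2 t) in
    let w t := w_of (q1 t) (p1 t) (q2 t) (p2 t) in
    alpha0 + alpha1 = 0 -> sigma (x t) (z t) != 0 ->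
  hamiltonian_system_at (K1 alpha0) (K2 alpha0) (K3 alpha0 alpha1) q1 p1 q2 p2 t
  <-> transformed_system_at alpha0 alpha1
    (in_new_coordinates (along_flow (K2 alpha0) dx_of))
    (in_new_coordinates (along_flow (K3 alpha0 alpha1) dx_of))
    (in_new_coordinates (along_flow (K2 alpha0) (dy_of alpha0)))
    (in_new_coordinates (along_flow (K3 alpha0 alpha1) (dy_of alpha0)))
    (in_new_coordinates (along_flow (K2 alpha0) dw_of))
    (in_new_coordinates (along_flow (K3 alpha0 alpha1) dw_of))
    x y z w t.
Proof.
move=> x y z w h_alpha s0; have [q20 _] := sigma_neq0P _ _ s0.
rewrite /hamiltonian_system_at (total_differential_transformation alpha0)//.
rewrite /transformed_system_at /= !in_new_coordinatesK//.
(* The composite coefficients are replaced first, because they contain [x t], [y t] and [w t], which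
   are themselves the simple coefficients replaced last. *)
rewrite -(y_along_K1 _ _ _ _ _ s0) -(z_along_K3 _ _ _ _ _ _ h_alpha s0).
rewrite -(z_along_K2 _ _ _ _ _ q20).
by rewrite -[y t]x_along_K1 -[w t](z_along_K1 alpha0) -[x t](w_along_K1 alpha0).
Qed.

End NewCoordinates.

Theorem theorem4p6 (R : realType) (alpha0 alpha1 : R[i])
    (h_alpha : alpha0 + alpha1 = 0) :
  birational (transformation alpha0) /\
  exists f1 f2 f3 f4 f5 f6 : R[i] -> R[i] -> R[i] -> R[i] -> R[i],
    [/\ regular_off_sigma f1, regular_off_sigma f2, regular_off_sigma f3,
        regular_off_sigma f4 & regular_off_sigma f5 /\ regular_off_sigma f6] /\
    forall q1 p1 q2 p2 : 'rV[R[i]]_3 -> R[i],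
      let x t := x_of (q1 t) (p1 t) (q2 t) (p2 t) in
      let y t := y_of alpha0 (q1 t) (p1 t) (q2 t) (p2 t) in
      let z t := z_of (q1 t) (p1 t) (q2 t) (p2 t) in
      let w t := w_of (q1 t) (p1 t) (q2 t) (p2 t) in
      forall U : set 'rV[R[i]]_3,
        (forall t, U t -> sigma (x t) (z t) != 0) ->
        (forall t, U t -> hamiltonian_system_at
           (K1 alpha0) (K2 alpha0) (K3 alpha0 alpha1) q1 p1 q2 p2 t) <->
        (forall t, U t -> transformed_system_at
           alpha0 alpha1 f1 f2 f3 f4 f5 f6 x y z w t).
Proof.
split; first exact: birational_transformation.
have [r1 r3 r5] := regular_along_K2 alpha0.
have [r2 r4 r6] := regular_along_K3 alpha0 alpha1.
(* The regularity facts determine the six witnesses by unification; odd indices come from [K2], even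
   ones from [K3]. *)
do 6!eexists; split; first exact: (And5 r1 r2 r3 r4 (conj r5 r6)).
move=> q1 p1 q2 p2 x y z w U s0.
(* The equivalence holds at each point separately, hence over an arbitrary set [U]. *)
by split=> sys t Ut;
  apply/(hamiltonian_transformed_at _ _ _ _ _ _ _ h_alpha (s0 t Ut)); exact: sys.
Qed.
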